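(* For any admissible meshes $\mathcal G_1,\mathcal G_2\in\mathbb A^{p,q}$, the overlay $\mathcal G_1\otimes\mathcal G_2$ is also admissible, i.e. $\mathcal G_1\otimes\mathcal G_2\in\mathbb A^{p,q}$.
   Context: Fix integers $p,q\ge 2$ (polynomial degrees) and positive integers $M,N$. Initial mesh: $\mathcal G_0=\{[m-1,m]\times[n-1,n]\mid 1\le m\le M,\ 1\le n\le N\}$, and $\overline\Omega=\bigcup\mathcal G_0=[0,M]\times[0,N]$. Elements are closed axis-parallel rectangles; a mesh is a set of elements obtained from $\mathcal G_0$ by bisections as defined below. Level: $\ell(K)=-\log_2|K|$, where $|K|$ is the area of $K$. Distance: for elements $K_1,K_2$, $\operatorname{Dist}(K_1,K_2)\in\mathbb R^2$ is the componentwise absolute value of $\operatorname{mid}(K_1)-\operatorname{mid}(K_2)$, where $\operatorname{mid}$ denotes the midpoint. Inequalities between vectors are componentwise. Patch: $\mathcal G^{p,q}(K)=\{K'\in\mathcal G\mid \operatorname{Dist}(K',K)\le \mathbf D^{p,q}(\ell(K))\}$, where $\mathbf D^{p,q}(k)=2^{-k/2}\bigl(\lfloor p/2\rfloor+\tfrac12,\ \lceil q/2\rceil+\tfrac12\bigr)$ if $k$ is even and $\mathbf D^{p,q}(k)=2^{-(k+1)/2}\bigl(\lceil p/2\rceil+\tfrac12,\ 2\lfloor q/2\rfloor+1\bigr)$ if $k$ is odd. Bisection: for $K=[\mu,\mu+\tilde\mu]\times[\nu,\nu+\tilde\nu]$, $\operatorname{child}(K)$ is the pair of rectangles obtained by halving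 $K$ in the $x$-direction (i.e. cutting along $x=\mu+\tilde\mu/2$) if $\ell(K)$ is even, and by halving $K$ in the $y$-direction (cutting along $y=\nu+\tilde\nu/2$) if $\ell(K)$ is odd. For $K\in\mathcal G$, $\operatorname{bisect}(\mathcal G,K)=(\mathcal G\setminus\{K\})\cup\operatorname{child}(K)$; for $\mathcal M=\{K_1,\dots,K_J\}\subseteq\mathcal G$, $\operatorname{bisect}(\mathcal G,\mathcal M)$ is the result of successively bisecting $K_1,\dots,K_J$ (in arbitrary order). Admissibility: the bisection of $K\in\mathcal G$ is admissible if all $K'\in\mathcal G^{p,q}(K)$ satisfy $\ell(K')\ge\ell(K)$. The bisection $\operatorname{bisect}(\mathcal G,\mathcal M)$ of several elements is admissible if the elements of $\mathcal M$ can be ordered such that it is a concatenation of admissible bisections of single elements (each with respect to the current mesh). A mesh $\mathcal G$ is admissible if it is $\mathcal G_0$ or there are meshes $\mathcal G_1,\dots,\mathcal G_J=\mathcal G$ and sets $\mathcal M_j\subseteq\mathcal G_j$ such that $\mathcal G_{j+1}=\operatorname{bisect}(\mathcal G_j,\mathcal M_j)$ is an admissible bisection for $j=0,\dots,J-1$. $\mathbb A^{p,q}$ is the set of all admissible meshes. Overlay: for a set $\mathcal S$ of elements, $\operatorname{Min}_\subseteq(\mathcal S)=\{K\in\mathcal S\mid\forall K'\in\mathcal S:\ K'\subseteq K\Rightarrow K'=K\}$, and $\mathcal G_1\otimes\mathcal G_2=\operatorname{Min}_\subseteq(\mathcal G_1\cup\mathcal G_2)$. *)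

(* Defs.v *)
From HB Require Import structures.
From mathcomp Require Import all_boot all_order all_algebra.
From mathcomp Require Import all_classical all_reals all_analysis.

Set Implicit Arguments.
Unset Strict Implicit.
Unset Printing Implicit Defensive.

Import Order.TTheory GRing.Theory Num.Theory.

Local Open Scope classical_set_scope.
Local Open Scope ring_scope.

(* [Rect x w y h] stands for [x, x + w] * [y, y + h].  Positivity of [w] and
   [h] is not part of the type: it holds on the unit squares of the initial
   mesh and is preserved by bisection, so every element of an admissible mesh
   is nondegenerate and is determined by its set of points. *)
Record rect (R : realType) : Type :=
  Rect { xmin : R; width : R; ymin : R; height : R }.

HB.instance Definition _ (R : realType) := gen_eqMixin (rect R).
HB.instance Definition _ (R : realType) := gen_choiceMixin (rect R).

Section Elements.
Variable R : realType.
Implicit Types (K : rect R) (k : R).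

Definition points K : set (R * R) :=
  [set z | xmin K <= z.1 <= xmin K + width K /\
           ymin K <= z.2 <= ymin K + height K].

Definition area K : R := width K * height K.

Definition mid K : R * R := (xmin K + width K / 2, ymin K + height K / 2).

Definition Dist K1 K2 : R * R :=
  (`|(mid K1).1 - (mid K2).1|, `|(mid K1).2 - (mid K2).2|).

Definition level K : R := - (ln (area K) / ln 2).

(* Levels are real by definition; on elements of admissible meshes they are
   natural numbers, and there "not even" means "odd". *)
Definition even_level k : bool := k / 2 \is a Num.int.

Definition Dpq (p q : nat) k : R * R :=
  if even_level k then
    (2 `^ (- (k / 2)) * ((p./2)%:R + 1 / 2),
     2 `^ (- (k / 2)) * ((uphalf q)%:R + 1 / 2))
  else
    (2 `^ (- ((k + 1) / 2)) * ((uphalf p)%:R + 1 / 2),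
     2 `^ (- ((k + 1) / 2)) * (2 * (q./2)%:R + 1)).

Definition child K : set (rect R) :=
  if even_level (level K) then
    [set Rect (xmin K) (width K / 2) (ymin K) (height K);
         Rect (xmin K + width K / 2) (width K / 2) (ymin K) (height K)]
  else
    [set Rect (xmin K) (width K) (ymin K) (height K / 2);
         Rect (xmin K) (width K) (ymin K + height K / 2) (height K / 2)].

End Elements.

Section Meshes.
Variable R : realType.
Implicit Types (K : rect R) (G S : set (rect R)) (s : seq (rect R)).

Definition initial_mesh (M N : nat) : set (rect R) :=
  [set K | exists m n : nat, [/\ (1 <= m <= M)%N, (1 <= n <= N)%N &
                                 K = Rect (m%:R - 1) 1 (n%:R - 1) 1]].

Definition patch (p q : nat) G K : set (rect R) :=
  [set K' | [/\ G K', (Dist K' K).1 <= (Dpq p q (level K)).1 &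
                      (Dist K' K).2 <= (Dpq p q (level K)).2]].

Definition bisect G K : set (rect R) := (G `\ K) `|` child K.

Definition bisect_seq G s : set (rect R) := foldl bisect G s.

Definition admissible_bisect (p q : nat) G K : Prop :=
  G K /\ forall K', patch p q G K K' -> level K <= level K'.

Fixpoint admissible_bisect_seq (p q : nat) G s : Prop :=
  if s is K :: s' then
    admissible_bisect p q G K /\ admissible_bisect_seq p q (bisect G K) s'
  else True.

(* [G'] is bisect(G, MM), and this bisection is admissible: [s] is the
   ordering of the finite set [MM] of marked elements. *)
Definition admissible_bisection (p q : nat) G (MM G' : set (rect R)) : Prop :=
  MM `<=` G /\
  exists s, [/\ uniq s, [set` s] = MM, admissible_bisect_seq p q G s &
                G' = bisect_seq G s].

Inductive admissible_mesh (p q M N : nat) : set (rect R) -> Prop :=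
| admissible_initial : admissible_mesh p q M N (initial_mesh M N)
| admissible_step G MM G' :
    admissible_mesh p q M N G -> admissible_bisection p q G MM G' ->
    admissible_mesh p q M N G'.

Definition min_subset S : set (rect R) :=
  [set K | S K /\ forall K', S K' -> points K' `<=` points K -> K' = K].

Definition overlay G1 G2 : set (rect R) := min_subset (G1 `|` G2).

End Meshes.

(* Main.v *)
Require Import Defs.
From HB Require Import structures.
From mathcomp Require Import all_boot all_order all_algebra.
From mathcomp Require Import all_classical all_reals all_analysis.
From mathcomp Require Import zify ring lra.

(* An admissible mesh is encoded by the finite set B of all tiles bisected on
   the way to it; its elements are the leaves of B, i.e. the tiles outside B
   whose parent is in B (or which belong to the initial mesh).  Bisecting a tile
   K is admissible iff all tiles of level l(K) within patch distance of K have
   their parent in B.  Hence the sets B that arise are exactly the finite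
   sets such that for every K in B, the parents of all tiles of level l(K) near
   K are in B: the bisections in such a set can be performed in order of
   increasing level.  This closure property is preserved by unions, and the
   overlay of the meshes encoded by B and C is the mesh encoded by their
   union. *)

Set Implicit Arguments.
Unset Strict Implicit.
Unset Printing Implicit Defensive.

Import Order.TTheory GRing.Theory Num.Theory.

Local Open Scope classical_set_scope.
Local Open Scope ring_scope.

(** * Combinatorics of dyadic tiles and of closed sets of bisected tiles *)

Section Tiles.
Variables p q M N : nat.
Local Open Scope nat_scope.

(* [(k, i, j)] stands for the level-[k] rectangle
   [i w, (i + 1) w] * [j h, (j + 1) h], w = 2^-ceil(k/2), h = 2^-floor(k/2). *)
Definition tile : Type := (nat * nat * nat)%type.
Implicit Types (t s u : tile) (B C : seq tile).

Definition lev t : nat := t.1.1.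

Definition in_domain t : bool :=
  (t.1.2 < M * 2 ^ uphalf (lev t)) && (t.2 < N * 2 ^ (lev t)./2).

(** The ancestor of [t] at level [l], meaningful only for [l <= lev t]: beyond that the truncated
    differences vanish and the indices stay unchanged. *)
Definition coarsen l t : tile :=
  (l, t.1.2 %/ 2 ^ (uphalf (lev t) - uphalf l), t.2 %/ 2 ^ ((lev t)./2 - l./2)).

(* [parent t = t] if [lev t = 0]. *)
Definition parent t : tile := coarsen (lev t).-1 t.

Definition children t : seq tile :=
  let: (k, i, j) := t in
  if odd k then [:: (k.+1, i, j.*2); (k.+1, i, j.*2.+1)]
  else [:: (k.+1, i.*2, j); (k.+1, i.*2.+1, j)].

Definition dist_le r i i' : bool := (i <= i' + r) && (i' <= i + r).

(* The half-widths of [Dpq p q k], measured in tiles of level [k], are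
   [xrad k + 1/2] and [yrad k + 1/2]. *)
Definition xrad k : nat := if odd k then uphalf p else p./2.
Definition yrad k : nat := if odd k then q./2 else uphalf q.

Definition nearby s t : bool :=
  [&& lev s == lev t, dist_le (xrad (lev s)) s.1.2 t.1.2
    & dist_le (yrad (lev s)) s.2 t.2].

(* [B] is the set of all tiles bisected so far. *)
Definition good B : Prop :=
  {in B, forall t, in_domain t} /\
  forall s t, s \in B -> 0 < lev s -> in_domain t -> nearby s t -> parent t \in B.

Definition leaf B t : bool :=
  [&& in_domain t, (lev t == 0) || (parent t \in B) & t \notin B].

Definition subtile t s : bool := (lev s <= lev t) && (coarsen (lev s) t == s).

Lemma coarsen_id t : coarsen (lev t) t = t.
Proof. by case: t => [[k i] j]; rewrite /coarsen /lev /= !subnn !divn1. Qed.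

Lemma coarsen_coarsen l m t : l <= m <= lev t ->
  coarsen l (coarsen m t) = coarsen l t.
Proof.
move=> /andP[lm mt]; rewrite /coarsen /lev /= -!divnMA -!expnD.
by congr (_, _ %/ 2 ^ _, _ %/ 2 ^ _); rewrite -/(lev t); lia.
Qed.

Lemma subtile_refl t : subtile t t.
Proof. by rewrite /subtile leqnn coarsen_id eqxx. Qed.

Lemma subtile_anti t s : subtile t s -> subtile s t -> t = s.
Proof.
move=> /andP[st /eqP ts] /andP[ts' _]; rewrite -ts.
by rewrite (_ : lev s = lev t) ?coarsen_id //; apply/eqP; rewrite eqn_leq st.
Qed.

Lemma in_domain_coarsen l t : l <= lev t -> in_domain (coarsen l t) = in_domain t.
Proof.
move=> lt; rewrite /in_domain /coarsen /lev /= !ltn_divLR ?expn_gt0// -!mulnA.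
by rewrite -!expnD -/(lev t) !subnKC //; lia.
Qed.

Lemma parentS k i j :
  parent (k.+1, i, j) = if odd k then (k, i, j./2) else (k, i./2, j).
Proof.
rewrite /parent /coarsen /lev /= (_ : (k./2).+1 - uphalf k = ~~ odd k); last lia.
rewrite (_ : uphalf k - k./2 = odd k); last lia.
by case: (odd k); rewrite /= ?divn1 ?divn2.
Qed.

Lemma lev_parent t : lev (parent t) = (lev t).-1.
Proof. by []. Qed.

Lemma in_domain_parent t : in_domain (parent t) = in_domain t.
Proof. by rewrite in_domain_coarsen // leq_pred. Qed.

Lemma mem_children s t :
  (s \in children t) = (lev s == (lev t).+1) && (parent s == t).
Proof.
case: t s => [[k i] j] [[l a] b]; rewrite /children /lev /=.
have [->|kl] := eqVneq l k.+1; rewrite ?parentS /=.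
  by case: ifP => _; rewrite !inE !xpair_eqE !eqxx /=; lia.
by case: ifP => _; rewrite !inE !xpair_eqE (negPf kl).
Qed.

Lemma nearby_refl t : nearby t t.
Proof. by rewrite /nearby /dist_le eqxx !leq_addr. Qed.

(** The coordinate halved by [parent] is the one with the rounded-up radius, say [uphalf p]. Halving
    leaves an index difference of at most [uphalf (uphalf p)], which is at most [p./2] once
    [2 <= p]. The radius of the other coordinate does not shrink. *)
Lemma nearby_parent (hp : 2 <= p) (hq : 2 <= q) s t :
  nearby s t -> nearby (parent s) (parent t).
Proof.
case: s t => [[k i] j] [[l a] b] /and3P[/eqP]; rewrite /lev /= => <- {l}.
case: k => [|k]; first by move=> ni nj; apply/and3P; rewrite /parent !coarsen_id.
rewrite !parentS /nearby /dist_le /xrad /yrad /lev /=.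
by case: (boolP (odd k)) => ok /= ni nj; rewrite ?ok ?(negPf ok);
  apply/and3P; split=> //; lia.
Qed.

Lemma good_parent B t : good B -> t \in B -> parent t \in B.
Proof.
move=> [dB nB] tB; case: (posnP (lev t)) => [t0|t0]; last first.
  exact: nB tB t0 (dB _ tB) (nearby_refl t).
suff -> : parent t = t by [].
by rewrite -[RHS]coarsen_id /parent t0.
Qed.

Lemma good_coarsen B t l : good B -> t \in B -> l <= lev t -> coarsen l t \in B.
Proof.
move=> gB; move: {2}(lev t) (erefl (lev t)) => n.
elim: n t => [|n IHn] t tn tB lt.
  by move: lt; rewrite tn leqn0 => /eqP->; rewrite -tn coarsen_id.
have [->|ln] := eqVneq l (lev t); first by rewrite coarsen_id.
have -> : coarsen l t = coarsen l (parent t).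
  by rewrite coarsen_coarsen // leq_pred andbT; lia.
by apply: IHn; rewrite ?lev_parent; [lia|exact: good_parent|lia].
Qed.

(** No child of [t] can be in [B], since a good set contains the parents of its tiles and [t] is not
    in [B]. *)
Lemma leaf_cons B t s : good B -> leaf B t ->
  leaf (t :: B) s = (leaf B s && (s != t)) || (s \in children t).
Proof.
move=> gB /and3P[dt pt tB]; rewrite mem_children /leaf !inE negb_or.
have [->|st] := eqVneq s t; first by rewrite /= !andbF ltn_eqF.
have [ps|ps] := eqVneq (parent s) t; last by rewrite /= andbF orbF andbT.
have ds : in_domain s by rewrite -in_domain_parent ps.
have -> : s \notin B by apply: contra tB; rewrite -ps; exact: good_parent.
rewrite ds ps (negPf tB) orbT !orbF !andbT /=.
have := lev_parent s; rewrite ps; case: (posnP (lev s)) => [s0|s0 ->].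
  by case/eqP: st; rewrite -ps -[LHS]coarsen_id /parent s0.
by rewrite prednK // eqxx orbT.
Qed.

(** If [u] is near [t], then [parent u] is near [parent t], which is in [B]; so [parent u] has level
    0 or its own parent is in [B]. Outside [B] it would be a leaf, which the last hypothesis
    excludes. *)
Lemma good_cons (hp : 2 <= p) (hq : 2 <= q) B t : good B -> leaf B t ->
  (forall u, in_domain u -> nearby t u -> 0 < lev t -> ~~ leaf B (parent u)) ->
  good (t :: B).
Proof.
move=> gB lt nl; have /and3P[dt pt tB] := lt; split=> [s|s u].
  by rewrite inE => /predU1P[->//|]; case: gB => dB _ /dB.
rewrite !inE => /predU1P[->|sB] s0 du nu; last first.
  by case: gB => _ /(_ _ _ sB s0 du nu) ->; rewrite orbT.
apply/orP; right; apply: contraNT (nl u du nu s0) => puB.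
rewrite /leaf in_domain_parent du puB andbT /=.
case: (posnP (lev (parent u))) => //= pu0.
have /eqP tu : lev t == lev u by case/and3P: nu.
have {}pt : parent t \in B by move: pt; rewrite (gtn_eqF s0).
case: gB => _; apply; first exact: pt.
- by rewrite lev_parent tu -lev_parent.
- by rewrite in_domain_parent.
- exact: nearby_parent.
Qed.

Lemma good_cat B C : good B -> good C -> good (B ++ C).
Proof.
move=> [dB nB] [dC nC]; split=> [s|s u].
  by rewrite mem_cat => /orP[/dB|/dC].
rewrite !mem_cat => /orP[sB|sC] s0 du nu; apply/orP.
  by left; exact: nB du nu.
by right; exact: nC du nu.
Qed.

Lemma ex_max_lev (P : pred tile) B : has P B ->
  exists2 t, (t \in B) && P t & {in B, forall s, P s -> lev s <= lev t}.
Proof.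
elim: B => //= t B IHB; have [/IHB[u /andP[uB Pu] um] _|hB] := boolP (has P B).
  case: (boolP (P t && (lev u < lev t))) => [/andP[Pt ut]|Nut].
    exists t; first by rewrite mem_head.
    move=> s; rewrite inE => /predU1P[->//|sB Ps].
    exact: leq_trans (um s sB Ps) (ltnW ut).
  exists u; first by rewrite inE uB orbT.
  move=> s; rewrite inE => /predU1P[-> Pt|]; last exact: um.
  by move: Nut; rewrite Pt -leqNgt.
rewrite orbF => Pt; exists t; first by rewrite mem_head.
move=> s; rewrite inE => /predU1P[->//|sB Ps].
by case/hasP: hB; exists s.
Qed.

(** Closure only demands tiles of level below that of some member, hence never [t]. *)
Lemma good_filter B t : good B -> {in B, forall s, lev s <= lev t} ->
  good [seq s <- B | s != t].
Proof.
move=> [dB nB] tm; split=> [s|s u]; first by rewrite mem_filter => /andP[_ /dB].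
rewrite !mem_filter => /andP[_ sB] s0 du nu; rewrite (nB s u)// andbT.
apply: contraTneq s0 => /(congr1 lev); rewrite lev_parent.
by have := tm _ sB; case/and3P: nu => /eqP <- _ _; lia.
Qed.

Lemma leaf_filter B t : good B -> t \in B -> leaf [seq s <- B | s != t] t.
Proof.
move=> gB tB; rewrite /leaf !mem_filter eqxx good_parent// !andbT.
have [-> // _] := gB; case: (posnP (lev t)) => //= t0.
by apply: contraTneq t0 => /(congr1 lev); rewrite lev_parent; lia.
Qed.

Lemma eq_leaf B C : B =i C -> leaf B =1 leaf C.
Proof. by move=> BC t; rewrite /leaf !BC. Qed.

(** A proper ancestor of [s] is an ancestor of [parent s], which is in [B], and good sets are closed
    under coarsening. *)
Lemma leaf_subtile_mem B s t :
  good B -> leaf B s -> subtile s t -> s != t -> t \in B.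
Proof.
move=> gB /and3P[_ ps _] /andP[ts /eqP st] sNt.
have {}ts : lev t < lev s.
  rewrite ltn_neqAle ts andbT; apply: contra sNt => /eqP ts'.
  by rewrite -st ts' coarsen_id.
move: ps; rewrite -st => /orP[/eqP s0|ps]; first by rewrite s0 in ts.
rewrite -(@coarsen_coarsen _ (lev s).-1); last by lia.
by apply: good_coarsen => //; rewrite lev_parent; lia.
Qed.

Lemma exists_leaf_subtile B t : good B -> t \in B ->
  exists2 s, leaf B s & subtile s t && (s != t).
Proof.
(* A deepest tile of [B] inside [t] has no child in [B], so its children are leaves. *)
move=> gB tB; have [|u /andP[uB ut] um] := @ex_max_lev (subtile^~ t) B.
  by apply/hasP; exists t => //; exact: subtile_refl.
have [s] : exists s, s \in children u.
  by case: u {uB ut um} => [[k i] j]; rewrite /children; case: ifP => _;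
    eexists; exact: mem_head.
rewrite mem_children => /andP[/eqP lsu /eqP su]; move: ut => /andP[tu /eqP ut].
have st : subtile s t.
  apply/andP; split; first by lia.
  rewrite -(@coarsen_coarsen _ (lev s).-1) -/(parent s) ?su ?ut //; lia.
exists s; last first.
  by rewrite st /=; apply: contraTneq isT => st'; rewrite st' in lsu; lia.
apply/and3P; split; last by apply/negP => /um/(_ st); lia.
  by rewrite -in_domain_parent su; case: gB => ->.
by rewrite su uB orbT.
Qed.

Lemma leaf_cat B C t : leaf (B ++ C) t -> leaf B t || leaf C t.
Proof.
rewrite /leaf !mem_cat negb_or => /and3P[-> + /andP[-> ->]].
by rewrite !andbT /=; case: eqP => //=.
Qed.

Lemma leaf_catl B C t : leaf B t -> t \notin C -> leaf (B ++ C) t.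
Proof.
rewrite /leaf !mem_cat negb_or => /and3P[-> + ->] -> /=.
by rewrite andbT orbA => ->.
Qed.

Lemma leaf_catC B C : leaf (B ++ C) =1 leaf (C ++ B).
Proof. by apply: eq_leaf => t; rewrite !mem_cat orbC. Qed.

End Tiles.

(** * Dyadic intervals: containment and distance of midpoints *)

Section Dyadic.
Variable R : realType.

Definition dyadic (a i : nat) : R := i%:R / 2 ^+ a.

Lemma dyadicD a i i' : dyadic a (i + i')%N = dyadic a i + dyadic a i'.
Proof. by rewrite /dyadic natrD mulrDl. Qed.

Lemma dyadic_refine a b i : (a <= b)%N -> dyadic a i = dyadic b (i * 2 ^ (b - a))%N.
Proof.
by move=> ab; rewrite /dyadic natrM natrX -{2}(subnK ab) exprD invfM mulrA mulfK.
Qed.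

Lemma dyadic_half a i : dyadic a i / 2 = dyadic a.+1 i.
Proof. by rewrite /dyadic exprSr invfM mulrA. Qed.

Lemma ler_dyadic a i j : (dyadic a i <= dyadic a j) = (i <= j)%N.
Proof. by rewrite /dyadic ler_pM2r ?ler_nat // invr_gt0 exprn_gt0. Qed.

Lemma dyadic_subset a b i j :
  dyadic a i <= dyadic b j -> dyadic b j.+1 <= dyadic a i.+1 ->
  (a <= b)%N /\ (j %/ 2 ^ (b - a))%N = i.
Proof.
move=> ij ji; have ab : (a <= b)%N.
  rewrite leqNgt; apply/negP => ba; move: ij ji.
  rewrite !(dyadic_refine _ (ltnW ba)) !ler_dyadic !mulSn => ij ji.
  have : (1 < 2 ^ (a - b))%N by rewrite -{1}(expn0 2) ltn_exp2l // subn_gt0.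
  by lia.
split=> //; move: ij ji; rewrite !(dyadic_refine _ ab) !ler_dyadic => ij ji.
apply/eqP; rewrite eqn_leq leq_divRL ?expn_gt0 // ij andbT.
by rewrite -ltnS ltn_divLR ?expn_gt0.
Qed.

Lemma subset_dyadic a b j : (a <= b)%N ->
  dyadic a (j %/ 2 ^ (b - a)) <= dyadic b j /\
  dyadic b j.+1 <= dyadic a (j %/ 2 ^ (b - a)).+1.
Proof.
move=> ab; rewrite !(dyadic_refine _ ab) !ler_dyadic leq_divM; split=> //.
by rewrite -ltn_divLR ?expn_gt0.
Qed.

(** Both midpoints and the bound are integer multiples of 2^-(b+1), so the comparison takes place in
    the naturals. *)
Lemma dyadic_dist a b i j r : (a <= b)%N ->
  (`|(dyadic a i + dyadic a 1 / 2) - (dyadic b j + dyadic b 1 / 2)|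
     <= dyadic b 1 * (r%:R + 1 / 2)) =
  (i.*2.+1 * 2 ^ (b - a) <= (j + r).+1.*2)%N &&
  (j.*2 <= i.*2.+1 * 2 ^ (b - a) + r.*2)%N.
Proof.
move=> ab; rewrite ler_distl; set s := (2 ^ (b - a))%N.
have -> : dyadic a i + dyadic a 1 / 2 = dyadic b.+1 (i.*2.+1 * s)%N.
  rewrite !(dyadic_refine _ ab) dyadic_half -/s mul1n.
  rewrite (@dyadic_refine b b.+1) // subSnn -dyadicD; congr dyadic; lia.
have -> : dyadic b j + dyadic b 1 / 2 = dyadic b.+1 j.*2.+1.
  rewrite dyadic_half (@dyadic_refine b b.+1) // subSnn -dyadicD; congr dyadic; lia.
have -> : dyadic b 1 * (r%:R + 1 / 2) = dyadic b.+1 r.*2.+1.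
  rewrite -dyadic_half /dyadic -[r.*2.+1]addn1 -mul2n natrD natrM.
  by field; rewrite expf_neq0 // pnatr_eq0.
rewrite lerBlDr -!dyadicD !ler_dyadic andbC; congr andb; lia.
Qed.

(* [j'] is the one closer to [j] among the two level-[b] intervals (one if
   [a = b]) that contain the midpoint of the coarse interval. *)
Lemma dyadic_dist_le a b i j r : (a <= b)%N ->
  `|(dyadic a i + dyadic a 1 / 2) - (dyadic b j + dyadic b 1 / 2)|
     <= dyadic b 1 * (r%:R + 1 / 2) ->
  exists2 j', dist_le r j j' & (j' %/ 2 ^ (b - a))%N = i.
Proof.
move=> ab; rewrite dyadic_dist // => /andP[].
case: (b - a)%N => [|c]; first by exists i; [rewrite /dist_le; lia|rewrite divn1].
rewrite expnS; have : (0 < 2 ^ c)%N by rewrite expn_gt0.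
set s := (2 ^ c)%N => s0 h1 h2.
have E d : (d < 2 * s)%N -> ((i * (2 * s) + d) %/ (2 * s))%N = i.
  by move=> ds; rewrite divnMDl ?divn_small ?addn0 //; lia.
have [js|js] := leqP (i * (2 * s) + s)%N j.
- by exists (i * (2 * s) + s)%N; [rewrite /dist_le; nia|apply: E; lia].
- by exists (i * (2 * s) + s.-1)%N; [rewrite /dist_le; nia|apply: E; lia].
Qed.

(** A parent is at most one halving away in each direction, hence the bound on [b]. If [b = a.+1],
    the coarse midpoint is an endpoint of the interval [j'], half a fine length from its midpoint;
    the [1 / 2] beyond [r] absorbs this. *)
Lemma dist_le_dyadic a b j j' r : (a <= b <= a.+1)%N -> dist_le r j j' ->
  `|(dyadic a (j' %/ 2 ^ (b - a))%N + dyadic a 1 / 2)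
     - (dyadic b j + dyadic b 1 / 2)| <= dyadic b 1 * (r%:R + 1 / 2).
Proof.
move=> /andP[ab ba] /andP[jj' j'j]; rewrite dyadic_dist //.
have [e|e] : (b - a = 0 \/ b - a = 1)%N by lia.
  by rewrite e divn1 muln1; lia.
by rewrite e expn1 divn2; lia.
Qed.

End Dyadic.

(** * Tiles as rectangles: levels, children, containment and patches *)

Section Rects.
Variable R : realType.
Implicit Types (s t : tile).

Definition rect_of t : rect R :=
  let: (k, i, j) := t in
  Rect (dyadic R (uphalf k) i) (dyadic R (uphalf k) 1)
       (dyadic R k./2 j) (dyadic R k./2 1).

Lemma level_rect_of t : level (rect_of t) = (lev t)%:R.
Proof.
case: t => [[k i] j]; rewrite /level /area /lev /= /dyadic !mul1r -invfM -exprD.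
have l2 : ln (2 : R) != 0 by rewrite gt_eqF // ln_gt0 // ltr1n.
rewrite uphalf_half -addnA addnn odd_double_half.
by rewrite lnV ?posrE ?exprn_gt0 // lnXn // -[ln _ *+ _]mulr_natl mulNr opprK mulfK.
Qed.

Lemma natr_half k : ~~ odd k -> k%:R / 2 = (k./2)%:R :> R.
Proof.
by move=> ok; rewrite -[in LHS](odd_double_half k) (negPf ok)
  -mul2n natrM mulrC mulKf.
Qed.

Lemma even_level_nat k : even_level (k%:R : R) = ~~ odd k.
Proof.
rewrite /even_level; case: (boolP (odd k)) => ok;
  last by rewrite natr_half // natr_int.
apply/negbTE/negP => /intrP[z kz].
have : (k%:Z)%:~R = (2 * z)%:~R :> R by rewrite intrM -kz mulrC divfK.
by move/intr_inj => h; move: ok; lia.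
Qed.

Lemma powR2_dyadic k : 2 `^ (- k%:R) = dyadic R k 1.
Proof. by rewrite powRN powR_mulrn // /dyadic mul1r. Qed.

Lemma Dpq_nat p q k :
  Dpq p q (k%:R : R) = (dyadic R (uphalf k) 1 * ((xrad p k)%:R + 1 / 2),
                        dyadic R k./2 1 * ((yrad q k)%:R + 1 / 2)).
Proof.
rewrite /Dpq even_level_nat /xrad /yrad; case: (boolP (odd k)) => ok /=; last first.
  by rewrite natr_half // powR2_dyadic (uphalf_half k) (negPf ok).
rewrite (natr1 k) natr_half /= ?ok // powR2_dyadic; congr pair.
(* For odd [k] the tile height 2^-floor(k/2) is twice 2^-((k+1)/2), which accounts for the doubled
   second entry of [Dpq]. *)
by rewrite (uphalf_half k) ok add1n -dyadic_half; field.
Qed.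

Lemma child_rect_of t : child (rect_of t) = rect_of @` [set` children t].
Proof.
have E (s u : tile) : rect_of @` [set` [:: s; u]] = [set rect_of s; rect_of u].
  apply/seteqP; split=> K; last first.
    by case=> ->; [exists s|exists u]; rewrite //= !inE eqxx ?orbT.
  by case=> v; rewrite /= !inE => /orP[] /eqP -> <-; [left|right].
have D a i : dyadic R a i = dyadic R a.+1 i.*2.
  by rewrite (dyadic_refine R i (leqnSn a)) subSnn expn1 muln2.
rewrite /child level_rect_of even_level_nat.
case: t => [[k i] j]; rewrite /children /lev [(_, _).1]/= if_neg.
case: (boolP (odd k)) => ok; rewrite E /= !dyadic_half (uphalf_half k).
  by rewrite ok add1n [dyadic R k./2 j]D -dyadicD addn1.
by rewrite (negPf ok) add0n [dyadic R k./2 i]D -dyadicD addn1.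
Qed.

Lemma points_rect_of t s :
  points (rect_of t) `<=` points (rect_of s) <-> subtile t s.
Proof.
case: t s => [[k i] j] [[l a] b]; rewrite /points /subtile /coarsen /lev /=.
rewrite -!dyadicD !addn1; split=> [sub|].
  (* Two opposite corners of the smaller rectangle carry all the inequalities needed. *)
  have /= := sub (dyadic R (uphalf k) i, dyadic R k./2 j).
  have /= := sub (dyadic R (uphalf k) i.+1, dyadic R k./2 j.+1).
  rewrite !ler_dyadic !leqnn !leqnSn /=.
  move=> /(_ (conj isT isT))[/andP[_ hx] /andP[_ hy]].
  move=> /(_ (conj isT isT))[/andP[hx' _] /andP[hy' _]].
  have [lk1 ->] := dyadic_subset hx' hx; have [lk2 ->] := dyadic_subset hy' hy.
  by rewrite eqxx andbT; lia.
move=> /andP[lk /eqP[<- <-]] [x y] /= [/andP[x1 x2] /andP[y1 y2]].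
have [|hx hx'] := @subset_dyadic R (uphalf l) (uphalf k) i; first by lia.
have [|hy hy'] := @subset_dyadic R l./2 k./2 j; first by lia.
split; apply/andP; split.
- exact: le_trans x1.
- exact: le_trans hx'.
- exact: le_trans y1.
- exact: le_trans hy'.
Qed.

Lemma rect_of_inj : injective rect_of.
Proof.
move=> t s ts; apply: subtile_anti; apply/points_rect_of;
  rewrite ts; exact: subset_refl.
Qed.

Lemma nearby_patch p q (G : set (rect R)) t u :
  G (rect_of (parent u)) -> nearby p q t u ->
  Defs.patch p q G (rect_of t) (rect_of (parent u)).
Proof.
rewrite /Defs.patch /= level_rect_of Dpq_nat.
case: t u => [[k i] j] [[l a] b] Gu /and3P[/eqP]; rewrite /lev /= => kl.
rewrite -kl in Gu * => nx ny; split=> //=.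
  by apply: dist_le_dyadic => //; rewrite /lev /=; lia.
by apply: dist_le_dyadic => //; rewrite /lev /=; lia.
Qed.

(** Each direction separately yields an index at level [lev t] inside [s]; together they form
    [u]. *)
Lemma patch_nearby p q (G : set (rect R)) t s : (lev s <= lev t)%N ->
  Defs.patch p q G (rect_of t) (rect_of s) ->
  exists u, nearby p q t u /\ coarsen (lev s) u = s.
Proof.
rewrite /Defs.patch /= level_rect_of Dpq_nat.
case: t s => [[k i] j] [[l a] b]; rewrite /lev /= => lk [_ hx hy].
have [|i' ni ei] := dyadic_dist_le _ hx; first by lia.
have [|j' nj ej] := dyadic_dist_le _ hy; first by lia.
by exists (k, i', j'); rewrite /nearby /coarsen /lev /= eqxx ni nj ei ej.
Qed.

(** * Meshes encoded by good sets, and their overlay *)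

Section Meshes.
Variables p q M N : nat.

Definition mesh (B : seq tile) : set (rect R) := rect_of @` [set t | leaf M N B t].

Lemma mesh_nil : mesh [::] = initial_mesh M N.
Proof.
have E m : m.+1%:R - 1 = dyadic R 0 m by rewrite /dyadic expr0 divr1 -natr1 addrK.
have E1 : 1 = dyadic R 0 1 by rewrite /dyadic expr0 divr1.
apply/seteqP; split=> K.
  case=> -[[k i] j] /and3P[]; rewrite in_nil orbF /in_domain /lev /=.
  move=> /andP[ik jk] /eqP k0 _.
  move: ik jk; rewrite k0 /= !muln1 => iM jN <-; exists i.+1, j.+1; split=> //.
  by rewrite !E -E1.
case=> -[|m] [[|n] [// mM nN ->]]; exists (0, m, n)%N.
  by move: mM nN; rewrite /leaf /in_domain /lev /= !muln1 => -> ->.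
by rewrite /= !E -E1.
Qed.

Lemma mem_mesh B t : mesh B (rect_of t) = leaf M N B t.
Proof.
by apply/propext; split=> [[s ls /rect_of_inj <-]|lt] //; exists t.
Qed.

Lemma mesh_cons B t : good p q M N B -> leaf M N B t ->
  mesh (t :: B) = bisect (mesh B) (rect_of t).
Proof.
move=> gB lt; rewrite /bisect child_rect_of; apply/seteqP; split=> K.
  case=> s /=; rewrite (leaf_cons _ gB lt) => /orP[/andP[ls st] <-|st <-].
    left; split; first by exists s.
    by move=> /rect_of_inj /eqP; rewrite (negPf st).
  by right; exists s.
case=> [[[s /= ls <-] st]|[s /= st <-]]; exists s => //=;
  rewrite (leaf_cons _ gB lt).
  by rewrite ls; case: eqP st => // -> /(_ erefl).
by rewrite st orbT.
Qed.

(** If the parent of a nearby [u] were a mesh element, it would lie in the patch of [t] with level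
    one less than that of [t], against admissibility. *)
Lemma mesh_admissible_bisect (hp : (2 <= p)%N) (hq : (2 <= q)%N) B t :
  good p q M N B ->
  admissible_bisect p q (mesh B) (rect_of t) ->
  leaf M N B t /\ good p q M N (t :: B).
Proof.
move=> gB []; rewrite mem_mesh => lt adm; split=> //.
apply: (good_cons hp hq) => // u du nu t0; apply/negP => lu.
have /adm : Defs.patch p q (mesh B) (rect_of t) (rect_of (parent u)).
  by apply: nearby_patch => //; rewrite mem_mesh.
rewrite !level_rect_of ler_nat lev_parent.
by case/and3P: nu => /eqP; lia.
Qed.

Lemma mesh_bisect_seq (hp : (2 <= p)%N) (hq : (2 <= q)%N) B r :
  good p q M N B ->
  admissible_bisect_seq p q (mesh B) r ->
  exists2 C, good p q M N C & bisect_seq (mesh B) r = mesh C.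
Proof.
elim: r B => [|K r IHr] B gB /=; first by exists B.
case=> -[/[dup] [[t lt <-]] BK adm] admr.
have [_ gtB] := mesh_admissible_bisect hp hq gB (conj BK adm).
by rewrite -(mesh_cons gB lt) in admr *; exact: IHr.
Qed.

Lemma admissible_mesh_good (hp : (2 <= p)%N) (hq : (2 <= q)%N) G :
  admissible_mesh p q M N G ->
  exists2 B, good p q M N B & G = mesh B.
Proof.
elim=> [|{}G MM G' _ [B gB ->] [_ [r [_ _ admr ->]]]].
  by exists [::]; [split=> // | rewrite mesh_nil].
by have [C gC ->] := mesh_bisect_seq hp hq gB admr; exists C.
Qed.

Lemma eq_mesh B C : B =i C -> mesh B = mesh C.
Proof.
by move=> BC; congr image; apply/seteqP; split=> t /=; rewrite (eq_leaf _ _ BC).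
Qed.

(** Induction on the size of [B]: a tile of maximal level is bisected last, as a single marked
    element. *)
Lemma good_admissible_mesh B : good p q M N B -> admissible_mesh p q M N (mesh B).
Proof.
have [n] := ubnP (size B); elim: n B => // n IHn B Bn gB.
have [/size0nil->|B0] := posnP (size B).
  by rewrite mesh_nil; exact: admissible_initial.
have [|t] := @ex_max_lev predT B; first by rewrite has_predT.
rewrite andbT => tB tmax'; have tmax : {in B, forall s, lev s <= lev t}%N.
  by move=> s /tmax'; exact.
set C := [seq s <- B | s != t].
have gC : good p q M N C by exact: good_filter.
have lt : leaf M N C t by exact: leaf_filter gB tB.
have -> : mesh B = mesh (t :: C).
  by apply: eq_mesh => s; rewrite inE mem_filter; case: eqP => [->|_]; rewrite ?tB.
apply: (@admissible_step _ _ _ _ _ (mesh C) [set rect_of t]).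
  apply: IHn => //; rewrite -ltnS; apply: leq_trans Bn; rewrite ltnS.
  rewrite size_filter -(count_predC (pred1 t) B) -add1n leq_add2r.
  by rewrite -has_count has_pred1.
split; first by move=> _ ->; rewrite mem_mesh.
exists [:: rect_of t]; split=> //=.
- by apply/seteqP; split=> K /=; rewrite inE => /eqP.
- split=> //; split; first by rewrite mem_mesh.
  (* A patch element [s] coarser than [t] would contain some [u] near [t]. Closure puts [parent u],
     hence [s], in [B]; as [s] differs from [t] it is also in [C], so it is no leaf of [C]. *)
  move=> K' /[dup] [[[s ls <-] _ _]] st; rewrite !level_rect_of ler_nat leqNgt.
  apply/negP => lst; have [u [nu us]] := patch_nearby (ltnW lst) st.
  have /eqP ltu : lev t == lev u by case/and3P: nu.
  have dt : in_domain M N u.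
    by rewrite -(@in_domain_coarsen _ _ (lev s)) ?us -?ltu ?(ltnW lst) //;
      case/and3P: ls.
  have puB : parent u \in B.
    exact: gB.2 tB (leq_ltn_trans (leq0n _) lst) dt nu.
  have sB : s \in B.
    rewrite -us -(@coarsen_coarsen _ (lev u).-1); last by lia.
    by apply: (good_coarsen gB puB); rewrite lev_parent; lia.
  case/and3P: ls => _ _; rewrite mem_filter sB andbT negbK => /eqP st'.
  by rewrite st' ltnn in lst.
- exact: mesh_cons.
Qed.

Lemma overlay_mesh B C : good p q M N B -> good p q M N C ->
  overlay (mesh B) (mesh C) = mesh (B ++ C).
Proof.
move=> gB gC; apply/seteqP; split=> K.
  (* If a minimal element [t] were in [A'], some leaf of [A'] would lie strictly inside it. Stated
     for arbitrary [A] and [A'] to serve both orders. *)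
  have H A A' t : good p q M N A' -> leaf M N A t ->
      (forall K', (mesh A `|` mesh A') K' -> points K' `<=` points (rect_of t) ->
         K' = rect_of t) -> leaf M N (A ++ A') t.
    move=> gA' lt min; apply: leaf_catl => //; apply/negP => tA'.
    have [s ls /andP[st /eqP]] := exists_leaf_subtile gA' tA'; apply.
    apply: rect_of_inj; apply: min; first by right; rewrite mem_mesh.
    exact/points_rect_of.
  case=> -[[t lt <-] min|[t lt <-] min]; rewrite mem_mesh; first exact: H.
  by rewrite leaf_catC; apply: H => // K' ?; apply: min; rewrite setUC.
case=> t lt <-; split.
  by case/orP: (leaf_cat lt) => ?; [left|right]; rewrite mem_mesh.
(* A leaf of [A] strictly inside [t] would force [t] into [A], but a leaf of [B ++ C] lies outside
   both sets. *)
have tB s A : good p q M N A -> {subset A <= B ++ C} -> leaf M N A s ->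
    subtile s t -> s = t.
  move=> gA AB ls st; apply/eqP; apply: contraT => /(leaf_subtile_mem gA ls st)/AB.
  by case/and3P: lt => _ _ /negPf ->.
move=> _ [[s ls <-]|[s ls <-]] /points_rect_of st; congr rect_of.
  by apply: tB gB _ ls st => u; rewrite mem_cat => ->.
by apply: tB gC _ ls st => u; rewrite mem_cat orbC => ->.
Qed.

End Meshes.
End Rects.

Theorem proposition4p3 (R : realType) (p q M N : nat)
    (hp : (2 <= p)%N) (hq : (2 <= q)%N) (hM : (0 < M)%N) (hN : (0 < N)%N)
    (G1 G2 : set (rect R))
    (hG1 : admissible_mesh p q M N G1) (hG2 : admissible_mesh p q M N G2) :
  admissible_mesh p q M N (overlay G1 G2).
Proof.
have [B gB ->] := admissible_mesh_good hp hq hG1.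
have [C gC ->] := admissible_mesh_good hp hq hG2.
rewrite (overlay_mesh R gB gC). apply: good_admissible_mesh; exact: good_cat.
Qed.
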